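(* Let $(S,d)$ be a metric space and let $f:S\to\mathbb{R}$ be a $1$-Lipschitz function. Then the graph $G_f=\{(x,f(x)):x\in S\}$ of $f$, equipped with $$Q\big((x,f(x)),(y,f(y))\big)=d(x,y)+f(y)-f(x),\qquad W(x,f(x))=2f(x),\qquad x,y\in S,$$ is a weighted quasi-metric space with generalized weight $W$. Further, every weighted quasi-metric space with generalized weight can be constructed in a similar manner: for every weighted quasi-metric space $(M,q,\omega)$ with generalized weight $\omega$ there exist a metric space $(S,d)$ and a $1$-Lipschitz function $f:S\to\mathbb{R}$ such that $(M,q,\omega)$ is isomorphic to $(G_f,Q,W)$, with $Q$ and $W$ defined by the formulas displayed above.
   Context: A function $f:S\to\mathbb{R}$ on a metric space $(S,d)$ is $1$-Lipschitz if $|f(x)-f(y)|\le d(x,y)$ for all $x,y\in S$. A quasi-metric on a set $M$ is a function $q:M\times M\to[0,\infty)$ such that for all $x,y,z\in M$: (a) $q(x,x)=0$; (b) $q(x,y)\le q(x,z)+q(z,y)$; (c) $q(x,y)=q(y,x)=0$ implies $x=y$. A weighted quasi-metric space with generalized weight is a triple $(M,q,\omega)$ with $q$ a quasi-metric on $M$ and $\omega:M\to\mathbb{R}$ such that $q(x,y)+\omega(x)=q(y,x)+\omega(y)$ for all $x,y\in M$. An isomorphism from $(M,q,\omega)$ to $(M',q',\omega')$ is a bijection $\psi:M\to M'$ with $q(x,y)=q'(\psi(x),\psi(y))$ and $\omega(x)=\omega'(\psi(x))$ for all $x,y\in M$. *)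

(* Defs.v *)
From Stdlib Require Import Reals FinFun.

Open Scope R_scope.

Record quasi_metric {M : Type} (q : M -> M -> R) : Prop := {
  qm_nonneg : forall x y, 0 <= q x y;
  qm_refl : forall x, q x x = 0;
  qm_tri : forall x y z, q x y <= q x z + q z y;
  qm_sep : forall x y, q x y = 0 -> q y x = 0 -> x = y
}.

(* The weight is "generalized": it may take negative values. *)
Record weighted_quasi_metric {M : Type} (q : M -> M -> R) (w : M -> R) : Prop := {
  wqm_quasi : quasi_metric q;
  wqm_weight : forall x y, q x y + w x = q y x + w y
}.

Definition wqm_isomorphism {M M' : Type} (q : M -> M -> R) (w : M -> R)
    (q' : M' -> M' -> R) (w' : M' -> R) (psi : M -> M') : Prop :=
  Bijective psi /\
  (forall x y, q x y = q' (psi x) (psi y)) /\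
  (forall x, w x = w' (psi x)).

Definition lipschitz1 (X : Metric_Space) (f : Base X -> R) : Prop :=
  forall x y, Rabs (f x - f y) <= dist X x y.

Definition graph {A : Type} (f : A -> R) : Type :=
  { p : A * R | snd p = f (fst p) }.

Definition graph_pt {A : Type} (f : A -> R) (x : A) : graph f :=
  exist _ (x, f x) eq_refl.

(* The second coordinate of a point of the graph is the value of f there, so
   the formulas for Q and W are written with the two coordinates. *)
Definition graph_fst {A : Type} {f : A -> R} (p : graph f) : A :=
  fst (proj1_sig p).

Definition graph_snd {A : Type} {f : A -> R} (p : graph f) : R :=
  snd (proj1_sig p).

Definition graphQ (X : Metric_Space) (f : Base X -> R) (p p' : graph f) : R :=
  dist X (graph_fst p) (graph_fst p') + graph_snd p' - graph_snd p.

Definition graphW {A : Type} (f : A -> R) (p : graph f) : R :=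
  2 * graph_snd p.

Lemma graphQE (X : Metric_Space) (f : Base X -> R) (x y : Base X) :
  graphQ X f (graph_pt f x) (graph_pt f y) = dist X x y + f y - f x.
Proof. reflexivity. Qed.

Lemma graphWE (A : Type) (f : A -> R) (x : A) :
  graphW f (graph_pt f x) = 2 * f x.
Proof. reflexivity. Qed.

(* Main.v *)
(** A generalized weight satisfies [w y - w x = q x y - q y x], so [w / 2] is
    1-Lipschitz for the symmetrized distance [(q x y + q y x) / 2], and the two
    together recover [q x y = d x y + w y / 2 - w x / 2]. *)

Require Import Defs.
From Stdlib Require Import Reals FinFun Lra.

(** After splitting the pair, the membership proof [e : t = f x] has a variable on one side, so
    [subst] turns it into [eq_refl] and the two dependent pairs coincide, proofs included. *)
Lemma graph_pt_fst {A : Type} {f : A -> R} (p : graph f) :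
  graph_pt f (graph_fst p) = p.
Proof. destruct p as [[x t] e]; simpl in e; subst t; reflexivity. Qed.

Lemma graph_pt_bijective {A : Type} (f : A -> R) : Bijective (graph_pt f).
Proof.
  exists graph_fst; split; [reflexivity | exact graph_pt_fst].
Qed.

Lemma graph_weighted_quasi_metric (X : Metric_Space) (f : Base X -> R) :
  lipschitz1 X f -> weighted_quasi_metric (graphQ X f) (graphW f).
Proof.
  intros lip.
  split; [split |].
  - intros p p'.
    rewrite <- (graph_pt_fst p), <- (graph_pt_fst p'), graphQE.
    (* Only one side of the Lipschitz bound enters: [f x - f y <= dist X x y]. *)
    pose proof (Rle_trans _ _ _ (Rle_abs _) (lip (graph_fst p) (graph_fst p'))).
    lra.
  - intros p; rewrite <- (graph_pt_fst p), graphQE.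
    rewrite (proj2 (dist_refl X _ _) eq_refl); lra.
  - intros p p' p''; unfold graphQ.
    pose proof (dist_tri X (graph_fst p) (graph_fst p') (graph_fst p'')); lra.
  - intros p p'; unfold graphQ.
    (* Adding [H] and [H'] cancels the heights and leaves twice the distance equal to 0. *)
    rewrite (dist_sym X (graph_fst p') (graph_fst p)); intros H H'.
    rewrite <- (graph_pt_fst p), <- (graph_pt_fst p').
    f_equal; apply (dist_refl X); lra.
  - intros p p'; unfold graphQ, graphW.
    rewrite (dist_sym X (graph_fst p') (graph_fst p)); lra.
Qed.

(** Closed with [Defined] so that [Base] and [dist] reduce to [M] and the average of [q] below. *)
Definition symmetrization {M : Type} {q : M -> M -> R} (qm : quasi_metric q) :
  Metric_Space.
Proof.
  refine (Build_Metric_Space M (fun x y => (q x y + q y x) / 2) _ _ _ _).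
  - intros x y; pose proof (qm_nonneg q qm x y);
      pose proof (qm_nonneg q qm y x); lra.
  - intros x y; lra.
  - intros x y; split.
    + intros H; pose proof (qm_nonneg q qm x y); pose proof (qm_nonneg q qm y x).
      apply (qm_sep q qm); lra.
    + intros <-; rewrite (qm_refl q qm); lra.
  - intros x y z; pose proof (qm_tri q qm x y z);
      pose proof (qm_tri q qm y x z); lra.
Defined.

(** The difference of the two nonnegative numbers [q y x] and [q x y] is bounded in absolute value
    by their sum; halving gives the claim. *)
Lemma half_weight_lipschitz {M : Type} {q : M -> M -> R} {w : M -> R}
    (wqm : weighted_quasi_metric q w) :
  lipschitz1 (symmetrization (wqm_quasi q w wqm)) (fun x => w x / 2).
Proof.
  intros x y; simpl.
  pose proof (wqm_weight q w wqm x y).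
  pose proof (qm_nonneg q (wqm_quasi q w wqm) x y).
  pose proof (qm_nonneg q (wqm_quasi q w wqm) y x).
  apply Rabs_le; lra.
Qed.

Theorem theorem5p3 :
  (forall (X : Metric_Space) (f : Base X -> R),
     lipschitz1 X f ->
     weighted_quasi_metric (graphQ X f) (graphW f))
  /\
  (forall (M : Type) (q : M -> M -> R) (w : M -> R),
     weighted_quasi_metric q w ->
     exists (X : Metric_Space) (f : Base X -> R),
       lipschitz1 X f /\
       exists psi : M -> graph f,
         wqm_isomorphism q w (graphQ X f) (graphW f) psi).
Proof.
  split; [exact graph_weighted_quasi_metric |].
  intros M q w wqm.
  exists (symmetrization (wqm_quasi q w wqm)), (fun x => w x / 2).
  split; [exact (half_weight_lipschitz wqm) |].
  (* The metric space has carrier [M] itself, so each point is sent to the graph point above it; the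
     factor 2 in [graphW] undoes the halving of [w]. *)
  exists (graph_pt (fun x : M => w x / 2)).
  split; [exact (graph_pt_bijective _) | split].
  - intros x y; rewrite graphQE; simpl.
    pose proof (wqm_weight q w wqm x y); lra.
  - intros x; rewrite graphWE; lra.
Qed.
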